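(* Let $\mu^+,\mu^-$ be two finite measures with finite supports on the Euclidean plane $\mathbb{R}^2$ with $\mu^+(\mathbb{R}^2)=\mu^-(\mathbb{R}^2)$, and assume that the cost function $C\colon[0,\infty)\to[0,\infty)$ is admissible. If a $(\mu^+,\mu^-)$-flow has a branching point of degree at least $4$, then there exists a $(\mu^+,\mu^-)$-flow with strictly smaller value of the Gilbert functional (with cost function $C$).
   Context: Let $\mu^+,\mu^-$ be two finite measures with finite supports on $\mathbb{R}^2$ (with Euclidean distance $\rho$) and equal total masses. A $(\mu^+,\mu^-)$-flow consists of: a finite set $V\subset\mathbb{R}^2$ (vertices) containing the support of the signed measure $\mu^+-\mu^-$; a finite collection $E$ of unordered pairs $\{x,y\}\subset V$, $x\neq y$ (edges), so that $(V,E)$ is a finite simple undirected graph; and, for every $\{x,y\}\in E$, two non-zero real numbers $m(x,y)$ and $m(y,x)$ with $m(x,y)+m(y,x)=0$, such that $$\mu^+-\mu^-=\sum_{\{x,y\}\in E} m(x,y)\,(\delta_y-\delta_x),$$ where $\delta_x$ is the delta-measure at $x$. (The vertex set $V$ is part of the data of the flow and may vary between flows.) Given a cost function $C\colon[0,\infty)\to[0,\infty)$, the Gilbert functional of the flow is $\sum_{\{x,y\}\in E} C(|m(x,y)|)\,\rho(x,y)$. A branching point of the flow is a vertex in $V\setminus(\operatorname{supp}(\mu^+)\cup\operatorname{supp}(\mu^-))$. Its degree is its degree in the graph $(V,E)$. A function $f\colon\mathbb{R}_{\ge 0}\to\mathbb{R}_{\ge 0}$ is called admissible if there is a Borel measure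 $\lambda$ on $\mathbb{R}$ with uncountable support and $\int\min(x^2,1)\,d\lambda(x)<\infty$ such that $f(t)=\sqrt{\int\sin^2(tx)\,d\lambda(x)}$ for all $t\ge 0$. *)

(* Defs.v *)
From HB Require Import structures.
From mathcomp Require Import all_boot all_order all_algebra finmap.
From mathcomp Require Import all_classical all_reals all_analysis.

Set Implicit Arguments.
Unset Strict Implicit.
Unset Printing Implicit Defensive.

Import Order.TTheory GRing.Theory Num.Theory.
Import numFieldNormedType.Exports.

#[global] Open Scope classical_set_scope.
#[global] Open Scope ring_scope.

(* The plane with its product topology and its Borel sigma-algebra (the product
   of two copies of that of R). The norm of the library on a product is the
   maximum norm, hence the separate Euclidean distance below. *)
Notation plane R := (R * R)%type.

Section gilbert.
Variable R : realType.

Definition rho (x y : plane R) : R :=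
  Num.sqrt ((x.1 - y.1) ^+ 2 + (x.2 - y.2) ^+ 2).

Definition supp (T : topologicalType) (mu : set T -> \bar R) : set T :=
  [set x | forall U : set T, open U -> U x -> (0 < mu U)%E].

(* The support of a signed measure nu: the complement of the largest open set
   all of whose measurable subsets are nu-null. *)
Definition signed_supp (nu : set (plane R) -> \bar R) : set (plane R) :=
  [set x | forall U : set (plane R), open U -> U x ->
     exists A : set (plane R), [/\ measurable A, A `<=` U & nu A != 0%E]].

(* A function on [0, +oo[ is represented by a function on R whose values at
   negative arguments are irrelevant. *)
Definition admissible (f : R -> R) : Prop :=
  exists lam : {measure set R -> \bar R},
    [/\ ~ countable (supp lam),
        (\int[lam]_x (Num.min (x ^+ 2) 1)%:E < +oo)%E &
        forall t, 0 <= t ->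
          (f t)%:E = sqrte (\int[lam]_x ((sin (t * x)) ^+ 2)%:E)].

(* An ordering (x, y) of the two elements of an unordered pair e = {x, y}. It
   is only used to sum, over edges, expressions that are symmetric in x and y,
   so that the choice of the ordering is immaterial. *)
Definition ends (e : {fset plane R}) : plane R * plane R :=
  xget ((0, 0), (0, 0)) [set p | e = [fset p.1; p.2]%fset].

(* flow_m is only constrained, and only used, on pairs joined by an edge. *)
Record flow (mup mum : {finite_measure set (plane R) -> \bar R}) := Flow {
  flow_V : {fset plane R};
  flow_E : {fset {fset plane R}};
  flow_m : plane R -> plane R -> R;
  flow_supp : signed_supp (fun A => mup A - mum A)%E `<=` [set` flow_V];
  flow_edge : forall e, e \in flow_E ->
    exists x y, [/\ x \in flow_V, y \in flow_V, x != y
                  & e = [fset x; y]%fset];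
  flow_neq0 : forall x y, [fset x; y]%fset \in flow_E -> flow_m x y != 0;
  flow_anti : forall x y, [fset x; y]%fset \in flow_E ->
    flow_m x y + flow_m y x = 0;
  flow_eq : forall A : set (plane R), measurable A ->
    (mup A - mum A =
     \sum_(e <- flow_E) let: (x, y) := ends e in
       (flow_m x y)%:E * (\d_y A - \d_x A))%E
}.

Definition gilbert (C : R -> R) mup mum (F : flow mup mum) : R :=
  \sum_(e <- flow_E F) let: (x, y) := ends e in
    C `|flow_m F x y| * rho x y.

Definition branching_point mup mum (F : flow mup mum) (v : plane R) : Prop :=
  [/\ v \in flow_V F, ~ supp mup v & ~ supp mum v].

Definition degree mup mum (F : flow mup mum) (v : plane R) : nat :=
  #|` [fset e in flow_E F | v \in e]%fset|.

End gilbert.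

(* Main.v *)
Require Import Defs.
From HB Require Import structures.
From mathcomp Require Import all_boot all_order all_algebra finmap.
From mathcomp Require Import all_classical all_reals all_analysis.
From mathcomp Require Import measurable_realfun ring lra.
Import Order.TTheory GRing.Theory Num.Theory.
Import numFieldNormedType.Exports.

(**
Suppose that no flow is cheaper than F, and let v be a branching point whose
neighbors x carry the masses m_x and the forces w_x = C(|m_x|) u_x, where u_x is
the unit vector from v to x.

Forces. For a set J of neighbors, detach from v the edges to J, attach them to
a nearby point v' = v + e w_J, where w_J is the sum of the w_x over J, and join
v to v' by an edge carrying the sum m_J of the m_x ([split_flow]). To first
order in e the cost changes by e (C(|m_J|) |w_J| - |w_J|^2), so minimality
forces |w_J| <= C(|m_J|) ([minimal_force_le]). As v supports no mass, the m_x
sum to 0 ([balance]); since C(0) = 0, the w_x sum to 0 as well.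

Hilbert space. Admissibility says that C(|s - t|) is the distance between
phi(s) and phi(t) for the curve phi(t)(x) = (exp(2itx) - 1)/2 in L^2(lambda).
Distinct points of this curve are affinely independent: an affine relation between them
is an exponential sum which vanishes on the support of lambda, and such a sum
has only countably many zeros ([cos_sum_uncountable_zeros]). Equivalently,
C(|s - t|)^2 is a kernel of strictly negative type ([admissible_neg_type]).

Polygons. Two neighbors cannot lie in the same direction, by strict
subadditivity of C. Put the forces in the order of their directions. They are
the sides of a convex planar polygon Q; the corresponding partial sums of the
masses give a polygon phi(s_0), phi(s_1), ... in Hilbert space, with sides of
the same lengths, and by the force inequality its diagonals are at least as
long as those of Q. Such a pair of polygons with at least four vertices would
have to be congruent, as in the lemma of Cauchy on convex polygons, and this
contradicts affine independence. Quantitatively: let A, B, P, P' be four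
vertices of Q in this cyclic order, and a_i the coefficients of the affine
relation between them. The sum over the pairs i < j of a_i a_j |Q_i - Q_j|^2 is
0, whereas the sum of the a_i a_j C(|s_i - s_j|)^2 is negative, so that one
obtains a strict inequality between the excesses in squared length of the sides
and diagonals of the quadrilateral. With AB a fixed side and PP' running through
the other sides, these inequalities chain up ([convex_polygon_absurd]) and
contradict each other at the last vertex.
*)

Set Implicit Arguments.
Unset Strict Implicit.
Unset Printing Implicit Defensive.

(** * Zeros of sums of cosines *)

Section trig.
Variable R : realType.

(** At a non-isolated zero of [f] the derivative vanishes too, and a set of reals
has only countably many isolated points. *)
Lemma uncountable_zeros_derive (f f' : R -> R) (U : set R) :
    (forall x : R, is_derive x 1 f (f' x)) -> (forall x, U x -> f x = 0) ->
    ~ countable U ->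
  exists2 W : set R, ~ countable W & W `<=` U /\ (forall x, W x -> f' x = 0).
Proof.
move=> fD f0 ucU; exists (U `\` isolated U).
  move=> cW; apply: ucU.
  apply: (@sub_countable _ _ _ ((U `\` isolated U) `|` isolated U)).
    apply: subset_card_le => x Ux.
    by have [iso|niso] := pselect (isolated U x); [right | left].
  rewrite -bigcup2E; apply: bigcup_countable => //.
  by case=> [|[|]] //= _; exact: countable_isolated.
split=> [x []//|x [Ux niso]].
apply: contrapT => /eqP f'0; apply: niso; split; first exact: mem_set.
have [dfx dfE] := fD x.
have : (fun h => h^-1 *: ((f \o shift x) (h *: 1) - f x)) @ 0^' --> f' x.
  by rewrite -dfE; exact: dfx.
move=> /cvgr_neq0 /(_ f'0) /nbhs_ballP [e /= e0 eP].
have fneq (y : R) : ball x e y -> y != x -> f y != 0.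
  move=> /= xy yx; apply/eqP => fy0.
  have := eP (y - x); rewrite -ball_normE /= sub0r normrN distrC subr_eq0.
  by move=> /(_ xy yx); rewrite /= [_%:A]mulr1 subrK fy0 (f0 _ Ux) subrr scaler0 eqxx.
exists (ball x e); first exact: nbhsx_ballx.
apply/seteqP; split=> [y [/= xy Uy]|y /= ->]; last by split=> //; exact: ballxx.
by apply/eqP; apply: contraT => /(fneq _ xy); rewrite f0// eqxx.
Qed.

(** The derivatives of the sum [f] vanish on uncountable subsets of [U] as well.
If [s] is one of the frequencies, then [f'' + s^2 f] is a sum of the same kind
in which the term of frequency [s] has disappeared; this gives an induction on
the number of terms. Nonnegativity excludes a cancellation between the
frequencies [s] and [- s]. *)
Lemma cos_sum_uncountable_zeros (ps : seq (R * R)) (U : set R) :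
    uniq [seq p.2 | p <- ps] -> {in ps, forall p, 0 <= p.2} ->
    ~ countable U -> (forall x, U x -> \sum_(p <- ps) p.1 * cos (p.2 * x) = 0) ->
  {in ps, forall p, p.1 = 0}.
Proof.
move sz : (size ps) => n.
elim: n ps U sz => [|n IH] [|[a s] ps] U //= [sz] /andP[sps ups] ps0 ucU fU.
pose f (x : R) := \sum_(p <- (a, s) :: ps) p.1 * cos (p.2 * x).
have {}fU x : U x -> f x = 0 by exact: fU.
pose g x := \sum_(p <- (a, s) :: ps) - p.1 * p.2 * sin (p.2 * x).
pose h x := \sum_(p <- (a, s) :: ps) - p.1 * p.2 ^+ 2 * cos (p.2 * x).
have fD (x : R) : is_derive x 1 f (g x).
  rewrite /f /g; elim: (_ :: _) => [|p qs IHq].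
    by rewrite big_nil; under eq_fun do rewrite big_nil; exact: is_derive_cst.
  rewrite big_cons; under eq_fun do rewrite big_cons.
  apply: is_deriveD; apply: is_derive_eq; rewrite /GRing.scale/=; ring.
have gD (x : R) : is_derive x 1 g (h x).
  rewrite /g /h; elim: (_ :: _) => [|p qs IHq].
    by rewrite big_nil; under eq_fun do rewrite big_nil; exact: is_derive_cst.
  rewrite big_cons; under eq_fun do rewrite big_cons.
  apply: is_deriveD; apply: is_derive_eq; rewrite /GRing.scale/=; ring.
have [V ucV [VU gV]] := uncountable_zeros_derive fD fU ucU.
have [W ucW [WV hW]] := uncountable_zeros_derive gD gV ucV.
have a0 : {in ps, forall p, p.1 = 0}.
  pose qs := [seq (p.1 * (s ^+ 2 - p.2 ^+ 2), p.2) | p <- ps].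
  have : {in qs, forall p, p.1 = 0}.
    apply: (IH qs W) => //.
    - by rewrite size_map.
    - by rewrite -map_comp.
    - by move=> _ /mapP[p pps ->]/=; apply: ps0; rewrite inE pps orbT.
    move=> x Wx; have /(congr1 (fun y => s ^+ 2 * y)) := fU _ (VU _ (WV _ Wx)).
    rewrite big_map /=; transitivity (h x + s ^+ 2 * f x); last first.
      by rewrite (hW _ Wx) (fU _ (VU _ (WV _ Wx))) mulr0 addr0.
    rewrite /h /f !big_cons /= mulrDr addrACA mulr_sumr -big_split/=.
    rewrite [X in X + _](_ : _ = 0) ?add0r; last by ring.
    by apply: eq_bigr => p _; ring.
  move=> qs0 p pps; have /qs0/= : (p.1 * (s ^+ 2 - p.2 ^+ 2), p.2) \in qs by apply: map_f.
  move=> /eqP; rewrite mulf_eq0 => /orP[/eqP//|]; rewrite subr_eq0 eqrXn2//.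
  - by move=> /eqP sp; move/negP: sps; rewrite sp map_f.
  - by apply: (ps0 (a, s)); rewrite mem_head.
  - by apply: ps0; rewrite inE pps orbT.
move=> p; rewrite inE => /predU1P[->/=|]; last exact: a0.
have [x Wx] : W !=set0 by apply/set0P/eqP => W0; apply: ucW; rewrite W0; exact: countable0.
have ps00 (F : R * R -> R) : \sum_(p <- ps) p.1 * F p = 0.
  by rewrite big_seq big1// => q /a0 ->; rewrite mul0r.
have := fU x (VU _ (WV _ Wx)); rewrite /f big_cons ps00/= addr0 => acos.
have := gV x (WV _ Wx); rewrite /g big_cons/=.
under eq_bigr do rewrite mulNr -mulrN -mulrA.
rewrite ps00 addr0 => asin.
have [s0|s0] := eqVneq s 0; first by move: acos; rewrite s0 mul0r cos0 mulr1.
have {}asin : a * sin (s * x) = 0.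
  by apply: (mulfI s0); rewrite mulr0 -[RHS]oppr0 -[in RHS]asin; ring.
rewrite -[a]mulr1 -(cos2Dsin2 (s * x)) !expr2 mulrDr !mulrA acos asin; ring.
Qed.
End trig.

(** * Admissible functions and kernels of negative type *)

Section negative_type.
Variable R : realType.

(** As [sin^2 t = (1 - cos 2t) / 2], the left-hand side is minus half of the
squared modulus of [sum_i a i * exp (2 i (u i) x)]. *)
Lemma sum_sin2_sub (I : finType) (a u : I -> R) (x : R) :
    \sum_i a i = 0 ->
  \sum_i \sum_j a i * a j * sin ((u i - u j) * x) ^+ 2 =
  - 2^-1 * ((\sum_i a i * cos (2 * u i * x)) ^+ 2 +
            (\sum_i a i * sin (2 * u i * x)) ^+ 2).
Proof.
move=> a0; have sqE (b : I -> R) : (\sum_i b i) ^+ 2 = \sum_i \sum_j b i * b j.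
  by rewrite expr2 mulr_suml; under eq_bigr do rewrite mulr_sumr.
have -> : (\sum_i a i * cos (2 * u i * x)) ^+ 2 +
    (\sum_i a i * sin (2 * u i * x)) ^+ 2 =
    (\sum_i a i * cos (2 * u i * x)) ^+ 2 +
    (\sum_i a i * sin (2 * u i * x)) ^+ 2 - (\sum_i a i) ^+ 2.
  by rewrite a0 expr0n subr0.
rewrite !sqE -!big_split -sumrB mulr_sumr; apply: eq_bigr => i _ /=.
rewrite -!big_split -sumrB mulr_sumr; apply: eq_bigr => j _ /=.
have := cosB (2 * u i * x) (2 * u j * x).
have -> : 2 * u i * x - 2 * u j * x = ((u i - u j) * x) *+ 2 by rewrite mulr2n; ring.
rewrite cos_mulr2n mulr2n => cE; rewrite sin2cos2.
have -> : cos ((u i - u j) * x) ^+ 2 = 2^-1 * (1 +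
    (cos (2 * u i * x) * cos (2 * u j * x) + sin (2 * u i * x) * sin (2 * u j * x))).
  by rewrite -cE; field.
by field.
Qed.


(** Integrating [sum_sin2_sub] expresses the quadratic form as minus half the
integral of a nonnegative continuous function. If this integral vanished, the
function would vanish on the support of the measure, which is uncountable. *)
Lemma admissible_neg_type (C : R -> R) (I : finType) (a s : I -> R) (i0 : I) :
    admissible C -> injective s -> \sum_i a i = 0 -> a i0 != 0 ->
  \sum_i \sum_j a i * a j * C `|s i - s j| ^+ 2 < 0.
Proof.
move=> [lam [usupp _ CE]] sinj a0 ai0.
(* Only differences of frequencies matter, so they can be shifted to be
   nonnegative. *)
pose u i := s i + \sum_j `|s j|.
have uB i j : u i - u j = s i - s j by rewrite /u; ring.
have u_ge0 i : 0 <= u i.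
  rewrite /u (bigD1 i)//= addrA addr_ge0 ?sumr_ge0//.
  by rewrite -lerBlDl sub0r -normrN ler_norm.
have C2 t : ((C `|t| ^+ 2)%:E = \int[lam]_x (sin (t * x) ^+ 2)%:E)%E.
  rewrite EFin_expe CE ?normr_ge0// sqr_sqrte; last first.
    by apply: integral_ge0 => x _; rewrite lee_fin sqr_ge0.
  apply: eq_integral => x _; congr EFin.
  have [t0|t0] := ger0P t => //; by rewrite mulNr sinN sqrrN.
have msin t : measurable_fun [set: R] (EFin \o (fun x : R => sin (t * x) ^+ 2)).
  apply/measurable_EFinP; apply: continuous_measurable_fun => x.
  apply: continuousM; apply: continuous_comp (@continuous_sin _ _);
  exact: mulrl_continuous.
have isin t : lam.-integrable [set: R] (EFin \o (fun x : R => sin (t * x) ^+ 2)).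
  apply/integrableP; split=> //.
  under eq_integral do rewrite gee0_abs ?lee_fin ?sqr_ge0//.
  by rewrite -C2 ltry.
pose G (x : R) := (\sum_i a i * cos (2 * u i * x)) ^+ 2 +
            (\sum_i a i * sin (2 * u i * x)) ^+ 2.
have G_ge0 x : 0 <= G x by rewrite addr_ge0 ?sqr_ge0.
have GE : (\int[lam]_x (- 2^-1 * G x)%:E =
    (\sum_i \sum_j a i * a j * C `|s i - s j| ^+ 2)%:E)%E.
  under eq_integral => x _ do rewrite -sum_sin2_sub//.
  under eq_integral => x _.
    rewrite pair_bigA -sumEFin.
    under eq_bigr => p _ do rewrite EFinM.
    over.
  have ip (p : I * I) : lam.-integrable [set: R] (fun x =>
      (a p.1 * a p.2)%:E * (sin ((u p.1 - u p.2) * x) ^+ 2)%:E)%E.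
    by apply: integrableZl => //; exact: isin.
  rewrite integral_sum//.
  rewrite pair_bigA -sumEFin; apply: eq_bigr => p _.
  by rewrite (integralZl measurableT (isin _)) [RHS]EFinM -uB C2.
have Gc : continuous G.
  move=> x; rewrite /G.
  have cvgL c : (fun y : R => c * y) @ x --> c * x by exact: mulrl_continuous.
  apply: cvgD; rewrite !expr2; apply: cvgM; apply: (cvg_big add_continuous) => i _;
    apply: cvgMr; apply: continuous_comp (cvgL _) _;
    solve [exact: continuous_cos | exact: continuous_sin].
have mG : measurable_fun [set: R] (EFin \o (fun x : R => 2^-1 * G x)).
  apply/measurable_EFinP; apply: continuous_measurable_fun => x.
  by apply: cvgMr; exact: Gc.
have Gint_ge0 : (0 <= \int[lam]_x (2^-1 * G x)%:E)%E.
  by apply: integral_ge0 => x _; rewrite lee_fin mulr_ge0.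
have {}GE : ((\sum_i \sum_j a i * a j * C `|s i - s j| ^+ 2)%:E =
    - \int[lam]_x (2^-1 * G x)%:E)%E.
  rewrite -GE -integral_ge0N; last by move=> x _; rewrite lee_fin mulr_ge0.
  by apply: eq_integral => x _; rewrite mulNr EFinN.
rewrite -lte_fin GE oppe_lt0 lt_neqAle Gint_ge0 andbT eq_sym.
apply/eqP => K0.
have G0 : forall x, supp lam x -> G x = 0.
  move=> x suppx; apply/eqP; apply: contraT => Gx0.
  pose U := [set y : R | G y != 0]%classic.
  have oU : open U.
    by apply: (@open_comp _ _ G) (@open_neq R 0) => y _; exact: Gc.
  have := suppx _ oU Gx0.
  suff -> : (lam U = 0)%E by rewrite ltxx.
  apply/negligibleP; first exact: open_measurable.
  have [] := ae_eq_integral_abs lam measurableT mG.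
  under eq_integral do rewrite gee0_abs ?lee_fin ?mulr_ge0//.
  move=> /(_ K0) + _; apply: negligibleS => y /= Gy0 /(_ Logic.I) [] /eqP.
  by rewrite mulf_eq0 (negbTE Gy0) orbF invr_eq0 pnatr_eq0.
move/eqP: ai0; apply.
pose ps := [seq (a i, 2 * u i) | i <- enum I].
suff ps0 : {in ps, forall p, p.1 = 0}.
  apply: (ps0 (a i0, 2 * u i0)).
  by apply: (map_f (fun i => (a i, 2 * u i))); rewrite mem_enum.
apply: (cos_sum_uncountable_zeros (U := supp lam)) => //.
- rewrite -map_comp map_inj_uniq ?enum_uniq// => i j /= uij.
  by apply: sinj; apply/eqP; rewrite -subr_eq0 -uB; apply/eqP; lra.
- by move=> _ /mapP[i _ ->]/=; rewrite mulr_ge0.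
- move=> x /G0; rewrite big_map big_enum /= /G => /eqP.
  by rewrite paddr_eq0 ?sqr_ge0// sqrf_eq0 => /andP[/eqP].
Qed.

End negative_type.

(** * Convex polygons with lengthened diagonals *)

Section polygon.
Variable R : realType.
Variable K : R -> R.
Hypothesis KN : forall t, K (- t) = K t.
Hypothesis K0 : K 0 = 0.
(* [K (s - t)] is the squared distance of the points of parameters [s] and [t] on
   a curve, and [K_neg_type] the affine independence of four of these points. *)
Hypothesis K_neg_type : forall a1 a2 a3 a4 s1 s2 s3 s4,
  uniq [:: s1; s2; s3; s4] -> a1 + a2 + a3 + a4 = 0 -> a1 != 0 ->
  a1 * a2 * K (s1 - s2) + a1 * a3 * K (s1 - s3) + a1 * a4 * K (s1 - s4) +
  a2 * a3 * K (s2 - s3) + a2 * a4 * K (s2 - s4) + a3 * a4 * K (s3 - s4) < 0.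

(** The vectors [(X x, Y x)], for [x] in [e :: L], are the sides of a closed
polygon whose first side, from A = 0 to B, points in the direction of the first
axis. The direction of another side [x], with polar angle in ]0, 2 pi[, is encoded
by [k x], the cotangent of half that angle: with [l x > 0] one has
[X x = l x (k x ^ 2 - 1)] and [Y x = 2 (l x) (k x)]. Sorting by decreasing [k] thus
sorts the sides by angle, and the polygon is convex. A list [p] of sides stands
for the difference of two vertices. *)
Section chain.
Variables (T : eqType) (X Y M : T -> R) (e : T) (L : seq T) (l k : T -> R).

Notation SX p := (\sum_(x <- p) X x).
Notation SY p := (\sum_(x <- p) Y x).
Notation SM p := (\sum_(x <- p) M x).

(** The amount by which the squared length of a diagonal, or of a side, exceeds its
value in the planar polygon. *)
Definition defect (p : seq T) : R := K (SM p) - (SX p ^+ 2 + SY p ^+ 2).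

Hypothesis defect_ge0 : forall p, subseq p (e :: L) -> 0 <= defect p.
Hypothesis defect1 : forall x, x \in e :: L -> defect [:: x] = 0.
Hypothesis X_sum0 : X e + SX L = 0.
Hypothesis Y_sum0 : SY L = 0.
Hypothesis M_sum0 : M e + SM L = 0.
Hypotheses (Xe_gt0 : 0 < X e) (Ye0 : Y e = 0).
Hypothesis l_gt0 : {in L, forall x, 0 < l x}.
Hypothesis XE : {in L, forall x, X x = l x * (k x ^+ 2 - 1)}.
Hypothesis YE : {in L, forall x, Y x = 2 * l x * k x}.
Hypothesis L_sorted : pairwise (fun x y => k y < k x) L.

(** The condition on [k] says that both sides point to the same half-plane, upper or
lower. *)
Let cross_gt0 x y : x \in L -> y \in L -> k y < k x ->
  0 <= k y \/ k x < 0 -> 0 < X x * Y y - Y x * X y.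
Proof.
move=> xL yL kxy ks; rewrite !XE// !YE//.
rewrite [ltRHS](_ : _ = 2 * (l x * l y) * ((k x - k y) * (1 + k x * k y))); last by ring.
rewrite mulr_gt0//; first by rewrite mulr_gt0// mulr_gt0// l_gt0.
rewrite mulr_gt0 ?subr_gt0// ltr_pwDl//.
by case: ks => ?; [rewrite mulr_ge0// | rewrite mulr_le0]; lra.
Qed.

Let sumr_gt0 (f : T -> R) p : p != [::] -> {in p, forall x, 0 < f x} ->
  0 < \sum_(x <- p) f x.
Proof.
case: p => // x p _ f_gt0; rewrite big_cons ltr_pwDl ?f_gt0 ?mem_head//.
by rewrite big_seq sumr_ge0// => y yp; rewrite ltW// f_gt0// inE yp orbT.
Qed.

Let Y_gt0 x : x \in L -> (0 < Y x) = (0 < k x).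
Proof. by move=> xL; rewrite YE// pmulr_rgt0// mulr_gt0// l_gt0. Qed.

Let Y_lt0 x : x \in L -> (Y x < 0) = (k x < 0).
Proof. by move=> xL; rewrite YE// pmulr_rlt0// mulr_gt0// l_gt0. Qed.

Let k_split p q x y : L = p ++ q -> x \in p -> y \in q -> k y < k x.
Proof.
by move=> LE xp yq; move: L_sorted; rewrite LE pairwise_cat => /and3P[/allrelP/(_ _ _ xp yq)].
Qed.

(** The polygon lies on one side of the line AB: if [p] contains a side that does
not go up, then all the sides after [p] go down. *)
Let SY_prefix_gt0 p q : L = p ++ q -> p != [::] -> q != [::] -> 0 < SY p.
Proof.
move=> LE p0 q0; have [/allP pY|] := boolP (all (fun x => 0 < Y x) p).
  exact: sumr_gt0.
move=> /allPn[x xp Yx]; have xL : x \in L by rewrite LE mem_cat xp.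
have := Y_sum0; rewrite LE big_cat/= => /eqP; rewrite addr_eq0 => /eqP ->.
rewrite -sumrN; apply: sumr_gt0 => // y yq; have yL : y \in L by rewrite LE mem_cat yq orbT.
rewrite oppr_gt0 Y_lt0//; apply: lt_le_trans (k_split LE xp yq) _.
by rewrite leNgt -Y_gt0.
Qed.

(** Twice the signed area of the triangle B P P', where P = B + [p] and
P' = P + [x]; that of A P P' is [area p x + X e * Y x]. *)
Definition area p x := SX p * Y x - SY p * X x.

Let areaE p x : area p x = \sum_(y <- p) (X y * Y x - Y y * X x).
Proof. by rewrite sumrB -!mulr_suml. Qed.

(** If [x] does not go down, all the sides of [p] make a positive angle with it; if it
goes down, the sides that follow [x] are used instead, the polygon being closed. *)
Let area_gt0 p x q : L = p ++ x :: q -> p != [::] ->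
  0 < area p x /\ 0 <= area p x + X e * Y x.
Proof.
move=> LE p0; have xL : x \in L by rewrite LE mem_cat mem_head orbT.
have pL y : y \in p -> y \in L by rewrite LE mem_cat => ->.
have qL y : y \in q -> y \in L by rewrite LE mem_cat inE => ->; rewrite !orbT.
have [kx|kx] := lerP 0 (k x).
  have a0 : 0 < area p x.
    rewrite areaE; apply: sumr_gt0 => // y yp; apply: cross_gt0 (pL _ yp) xL _ _; last by left.
    by apply: (k_split LE yp); rewrite mem_head.
  split=> //; rewrite addr_ge0 ?(ltW a0)// mulr_ge0 ?(ltW Xe_gt0)//.
  by rewrite YE// mulr_ge0// mulr_ge0// ltW// l_gt0.
suff b0 : 0 <= area p x + X e * Y x.
  split=> //; rewrite -(ltrD2r (X e * Y x)) add0r (lt_le_trans _ b0)//.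
  by rewrite pmulr_rlt0// Y_lt0.
have -> : area p x + X e * Y x = \sum_(y <- q) (X x * Y y - Y x * X y).
  rewrite sumrB -!mulr_sumr /area.
  move: X_sum0 Y_sum0; rewrite LE !big_cat/= !big_cons => hX hY.
  have -> : X e = - (SX p + (X x + SX q)) by apply/eqP; rewrite -addr_eq0 hX.
  have -> : SY q = - (SY p + Y x) by apply/eqP; rewrite -addr_eq0 addrC -addrA hY.
  by ring.
rewrite big_seq; apply: sumr_ge0 => y yq; apply/ltW/(cross_gt0 xL (qL _ yq)); last by right.
by apply: (@k_split (rcons p x) q) => //; rewrite ?cat_rcons// mem_rcons mem_head.
Qed.

Let area_rcons p x : area (rcons p x) x = area p x.
Proof. by rewrite /area -cats1 !big_cat !big_seq1/=; ring. Qed.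

(** The strict negative type, applied to the affine relation between the vertices A,
B, P = B + [p] and P' = P + [x]. *)
Let quad p x q : L = p ++ x :: q -> p != [::] -> q != [::] ->
    (area p x + X e * Y x) * defect p <= area p x * defect (e :: p) ->
  (area p x + X e * Y x) * defect (rcons p x) <
  area p x * defect (e :: rcons p x).
Proof.
move=> LE p0 q0 inv.
have [a_gt0 b_ge0] := area_gt0 LE p0.
have xL : x \in L by rewrite LE mem_cat mem_head orbT.
have sp : SY p > 0 by apply: (SY_prefix_gt0 LE).
have LE' : L = rcons p x ++ q by rewrite cat_rcons.
have sp' : SY (rcons p x) > 0 by apply: (SY_prefix_gt0 LE') => //; case: (p).
have sub_p : subseq p L by rewrite LE prefix_subseq.
have sub_p' : subseq (rcons p x) L by rewrite LE' prefix_subseq.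
have := defect_ge0 (subseq_trans sub_p (subseq_cons _ _)).
have := defect_ge0 (subseq_trans sub_p' (subseq_cons _ _)).
have : 0 <= defect (e :: p) by rewrite defect_ge0//= eqxx.
have : 0 <= defect (e :: rcons p x) by rewrite defect_ge0//= eqxx.
have := defect1 (mem_head e L).
have : defect [:: x] = 0 by rewrite defect1// inE xL orbT.
move: inv sp'; rewrite /defect !big_cons !big_nil -cats1 !big_cat !big_seq1/=.
rewrite !addr0 Ye0 add0r expr0n addr0.
have aE : area p x = SX p * Y x - SY p * X x by [].
have w_gt0 : 0 < X x ^+ 2 + Y x ^+ 2.
  rewrite XE// YE// [ltRHS](_ : _ = (l x * (k x ^+ 2 + 1)) ^+ 2); last by ring.
  by rewrite exprn_even_gt0// mulf_neq0 ?gt_eqF ?l_gt0// ltr_wpDl ?sqr_ge0.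
move: (area p x) (SX p) (SY p) (SM p) (X x) (Y x) (M x) (X e) (M e)
  sp a_gt0 b_ge0 aE w_gt0 Xe_gt0.
move=> a sX sY sM Xx Yx Mx Xe Me sY_gt0 a_gt0 b_ge0 aE w_gt0 Xe0 inv sY'_gt0.
move=> Kx Ke dA' dA dB' dB.
have K_neq0 t : 0 < K t -> t != 0 by apply: contraTneq => ->; rewrite K0 ltxx.
have sq_gt0 (u v : R) : 0 < v -> 0 < u ^+ 2 + v ^+ 2.
  by move=> v0; rewrite ltr_wpDl ?sqr_ge0// exprn_gt0.
have pA := sq_gt0 (Xe + sX) _ sY_gt0; have pA' := sq_gt0 (Xe + (sX + Xx)) _ sY'_gt0.
have pB := sq_gt0 sX _ sY_gt0; have pB' := sq_gt0 (sX + Xx) _ sY'_gt0.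
have pe : 0 < Xe ^+ 2 by rewrite exprn_gt0.
have nA : Me + sM != 0 by apply: K_neq0; lra.
have nA' : Me + (sM + Mx) != 0 by apply: K_neq0; lra.
have nB : sM != 0 by apply: K_neq0; lra.
have nB' : sM + Mx != 0 by apply: K_neq0; lra.
have nx : Mx != 0 by apply: K_neq0; lra.
have ne : Me != 0 by apply: K_neq0; lra.
(* The coefficients of the affine relation are the signed areas of the
   triangles BPP', APP', ABP' and ABP, with alternating signs. *)
have s_uniq : uniq [:: 0; Me; Me + sM; Me + (sM + Mx)].
  rewrite /= !inE !negb_or !andbT ![0 == _]eq_sym ne nA nA' /=.
  rewrite ![Me == _]eq_sym -![_ == Me]subr_eq0 ![Me + _ - Me]addrAC !subrr !add0r nB nB'.
  by rewrite addrA -subr_eq0 opprD addrA subrr sub0r oppr_eq0.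
have coef_sum0 : a + - (a + Xe * Yx) + Xe * (sY + Yx) + - (Xe * sY) = 0 by ring.
have := K_neg_type s_uniq coef_sum0 (lt0r_neq0 a_gt0).
rewrite !sub0r !KN.
have -> : Me - (Me + sM) = - sM by ring.
have -> : Me - (Me + (sM + Mx)) = - (sM + Mx) by ring.
have -> : Me + sM - (Me + (sM + Mx)) = - Mx by ring.
rewrite !KN => neg.
rewrite -subr_gt0 -(pmulr_rgt0 _ (mulr_gt0 Xe0 sY_gt0)).
have := ler_wpM2l (ltW (mulr_gt0 Xe0 sY'_gt0)) inv.
move: neg; rewrite (_ : K Me = Xe ^+ 2); last by lra.
rewrite (_ : K Mx = Xx ^+ 2 + Yx ^+ 2); last by lra.
rewrite aE; lra.
Qed.

(** The inequality that [quad] gives at P' has the form required to continue from P',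
because the ratio of the areas A P P' and B P P' decreases along the polygon. At the
last vertex it is absurd: the segment from A is a side there and has defect 0. *)
Let chain q p x y : L = p ++ x :: y :: q -> p != [::] ->
  (area p x + X e * Y x) * defect p <= area p x * defect (e :: p) -> False.
Proof.
elim: q p x y => [|z q IH] p x y LE p0 inv; have lt := quad LE p0 isT inv;
    have [a_gt0 b_ge0] := area_gt0 LE p0.
  have LE' : L = rcons p x ++ [:: y] by rewrite cat_rcons.
  have dB : 0 <= defect (rcons p x).
    by apply/defect_ge0/(subseq_trans _ (subseq_cons _ _)); rewrite LE' prefix_subseq.
  have yL : y \in e :: L by rewrite LE' inE mem_cat mem_head !orbT.
  suff dA : defect (e :: rcons p x) = 0.
    by move: lt; rewrite dA mulr0 ltNge mulr_ge0.
  (* The sum of all sides but [y] is the opposite of [y]. *)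
  rewrite -(defect1 yL) /defect !big_seq1 !big_cons Ye0 add0r.
  move: X_sum0 Y_sum0 M_sum0; rewrite LE' !big_cat/= !big_seq1 !addrA.
  move=> /eqP hX /eqP hY /eqP hM.
  move: hX hY hM; rewrite !addr_eq0 => /eqP -> /eqP -> /eqP ->.
  by rewrite KN !sqrrN.
have LE' : L = rcons p x ++ y :: z :: q by rewrite cat_rcons.
have p'0 : rcons p x != [::] by case: (p).
apply: (IH _ _ _ LE' p'0).
have [a'_gt0 b'_ge0] := area_gt0 LE' p'0.
have sp' : 0 < SY (rcons p x) by apply: (SY_prefix_gt0 LE').
have dB : 0 <= defect (rcons p x).
  by apply/defect_ge0/(subseq_trans _ (subseq_cons _ _)); rewrite LE' prefix_subseq.
have xL : x \in L by rewrite LE mem_cat mem_head orbT.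
have yL : y \in L by rewrite LE' mem_cat mem_head orbT.
(* Up to the factor [X e], this is the difference of the two products of areas
   whose comparison says that their ratio decreases. *)
have slope : Y y * area p x <= Y x * area (rcons p x) y.
  have [yx|yx] := pselect (Y y <= 0 <= Y x).
    have /andP[y0 x0] := yx.
    apply: (@le_trans _ _ 0); first exact: mulr_le0_ge0 y0 (ltW a_gt0).
    exact: mulr_ge0 x0 (ltW a'_gt0).
  have cr : 0 < X x * Y y - Y x * X y.
    have kyx : k y < k x by apply: (k_split LE'); rewrite ?mem_rcons mem_head.
    apply: (cross_gt0 xL yL kyx); move/negP: yx.
    rewrite negb_and -!ltNge Y_gt0// Y_lt0// => /orP[/ltW|]; by [left|right].
  rewrite -subr_ge0 -(area_rcons p x) /area.
  rewrite [leRHS](_ : _ = SY (rcons p x) * (X x * Y y - Y x * X y)); last by ring.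
  by rewrite mulr_ge0// ltW.
rewrite -(ler_pM2l a_gt0).
apply: (@le_trans _ _
  (area (rcons p x) y * ((area p x + X e * Y x) * defect (rcons p x)))); last first.
  by rewrite [leRHS]mulrCA ler_pM2l// ltW.
rewrite [leLHS]mulrA [leRHS]mulrA ler_wpM2r// -subr_ge0.
rewrite [leRHS](_ : _ = X e * (Y x * area (rcons p x) y - Y y * area p x)); last by ring.
by rewrite mulr_ge0 ?(ltW Xe_gt0)// subr_ge0.
Qed.

Lemma convex_polygon_absurd : (2 < size L)%N -> False.
Proof.
case LE: L => [|x [|y [|z q]]]// _.
apply: (@chain q [:: x] y z) => //.
rewrite [defect [:: x]]defect1 ?LE ?inE ?eqxx ?orbT// mulr0 mulr_ge0//.
  by have [/ltW] := @area_gt0 [:: x] y (z :: q) LE isT.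
by apply: defect_ge0; rewrite LE; exact: (prefix_subseq [:: e; x]).
Qed.
End chain.
End polygon.

(** * Systems of forces at a point *)

Section star.
Variable R : realType.
Variable C : R -> R.
Hypothesis C_ge0 : forall t : R, 0 <= t -> 0 <= C t.
Hypothesis C_adm : admissible C.

Lemma admissible0 : C 0 = 0.
Proof.
have [lam [_ _ CE]] := C_adm; apply: EFin_inj; rewrite CE//.
rewrite (eq_integral (cst 0%E)) ?integral0 ?sqrte0// => x _.
by rewrite mul0r sin0 expr0n.
Qed.

Lemma admissible_gt0 (t : R) : t != 0 -> 0 < C `|t|.
Proof.
move=> t0; rewrite lt_neqAle C_ge0// andbT eq_sym; apply/negP => /eqP Ct.
have := @admissible_neg_type R C bool (fun b => (-1) ^+ b)
  (fun b => if b then t else 0) true C_adm.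
rewrite !big_bool/= !subrr subr0 sub0r normrN !normr0 admissible0 Ct expr0n/= !mulr0 !addr0 ltxx.
move=> H; suff : false by []; apply: H.
- by move=> [] [] //= /esym/eqP; rewrite ?(negbTE t0)// eq_sym (negbTE t0).
- by rewrite expr0 expr1 addrC subrr.
- by rewrite expr1 oppr_eq0 oner_eq0.
Qed.

Lemma admissible_neg_type4 (a1 a2 a3 a4 s1 s2 s3 s4 : R) :
  uniq [:: s1; s2; s3; s4] -> a1 + a2 + a3 + a4 = 0 -> a1 != 0 ->
  a1 * a2 * C `|s1 - s2| ^+ 2 + a1 * a3 * C `|s1 - s3| ^+ 2 +
  a1 * a4 * C `|s1 - s4| ^+ 2 + a2 * a3 * C `|s2 - s3| ^+ 2 +
  a2 * a4 * C `|s2 - s4| ^+ 2 + a3 * a4 * C `|s3 - s4| ^+ 2 < 0.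
Proof.
move=> sU a0 a1_neq0.
have := @admissible_neg_type R C 'I_4 (fun i => nth 0 [:: a1; a2; a3; a4] i)
  (fun i => nth 0 [:: s1; s2; s3; s4] i) ord0 C_adm.
rewrite !big_ord_recr !big_ord0/= !add0r !subrr normr0 admissible0 expr0n/=.
rewrite (distrC s2 s1) (distrC s3 s1) (distrC s4 s1) (distrC s3 s2) (distrC s4 s2) (distrC s4 s3).
move=> H; rewrite -(pmulr_rlt0 _ (ltr0Sn R 1)).
apply: le_lt_trans (H _ a0 a1_neq0); first by lra.
by move=> i j /eqP; rewrite nth_uniq// => /eqP/val_inj.
Qed.

(** The triangle inequality in the Hilbert space is strict, since the points of
parameters 0, [s] and [s + t] are not aligned. *)
Lemma admissible_strict_subadditive (s t : R) : s != 0 -> t != 0 ->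
  C `|s + t| < C `|s| + C `|t|.
Proof.
move=> s0 t0; have Cs := admissible_gt0 s0; have Ct := admissible_gt0 t0.
have [->|st0] := eqVneq (s + t) 0; first by rewrite normr0 admissible0 addr_gt0.
(* The coefficients are those of the affine relation between three aligned
   points at distances C(|s|) and C(|t|). *)
have := @admissible_neg_type R C 'I_3
  (fun i => nth 0 [:: C `|t|; - (C `|s| + C `|t|); C `|s|] i)
  (fun i => nth 0 [:: 0; s; s + t] i) ord0 C_adm.
rewrite !big_ord_recr !big_ord0/= !add0r !subrr !subr0 !normrN normr0 admissible0 expr0n/=.
have -> : s - (s + t) = - t by ring.
have -> : s + t - s = t by ring.
rewrite normrN => H.
have {}H := H _ _ (lt0r_neq0 Ct).
rewrite -ltr_sqr ?nnegrE ?C_ge0 ?addr_ge0 ?C_ge0//.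
rewrite -subr_gt0 -(pmulr_rgt0 _ (mulr_gt0 Cs Ct)) -(pmulr_rgt0 _ (ltr0Sn R 1)) -oppr_lt0.
apply: le_lt_trans (H _ _); [lra | | ring].
have sU : uniq [:: 0; s; s + t].
  rewrite /= !inE negb_or ![0 == _]eq_sym s0 st0/= andbT -subr_eq0 opprD addrA subrr sub0r.
  by rewrite oppr_eq0.
by move=> i j /eqP; rewrite nth_uniq// => /eqP/val_inj.
Qed.

Section rotate.
Variables (T : eqType) (N : seq T) (ux uy M : T -> R).
Hypothesis N_uniq : uniq N.
Hypothesis N_size : (3 < size N)%N.
Hypothesis u_norm : {in N, forall x, ux x ^+ 2 + uy x ^+ 2 = 1}.
Hypothesis M_neq0 : {in N, forall x, M x != 0}.
Hypothesis M_sum0 : \sum_(x <- N) M x = 0.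
Hypothesis force_le : forall p, uniq p -> {subset p <= N} ->
  (\sum_(x <- p) C `|M x| * ux x) ^+ 2 + (\sum_(x <- p) C `|M x| * uy x) ^+ 2 <=
  C `|\sum_(x <- p) M x| ^+ 2.

Let direction_inj : {in N &, forall x y, ux x = ux y -> uy x = uy y -> x = y}.
Proof.
move=> x y xN yN xyx xyy; apply/eqP; apply: contraT => xy.
have := @force_le [:: x; y]; rewrite !big_cons !big_nil !addr0 -xyx -xyy -!mulrDl !exprMn.
rewrite -mulrDr u_norm// mulr1 => H.
have := admissible_strict_subadditive (M_neq0 xN) (M_neq0 yN).
rewrite -ltr_sqr ?nnegrE ?addr_ge0 ?C_ge0// ltNge => /negP[]; apply: H.
  by rewrite /= inE xy.
by move=> z; rewrite !inE => /orP[] /eqP ->.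
Qed.

(** Turning the plane so that the first force has the direction of the first axis
and sorting the other ones by angle reduces the claim to [convex_polygon_absurd]. *)
Lemma star_absurd : False.
Proof.
case NE : N => [|e L0]; first by move: N_size; rewrite NE.
have eN : e \in N by rewrite NE mem_head.
have L0N x : x \in L0 -> x \in N by rewrite NE inE orbC => ->.
pose a x := ux x * ux e + uy x * uy e.
pose b x := ux e * uy x - uy e * ux x.
pose c x := C `|M x|.
(* [a x] and [b x] are the cosine and the sine of the angle from [e] to [x], and
   [k x] is the cotangent of half this angle. *)
pose k x := b x / (1 - a x).
have c_gt0 x : x \in N -> 0 < c x by move=> xN; apply/admissible_gt0/M_neq0.
have ab1 x : x \in N -> a x ^+ 2 + b x ^+ 2 = 1.
  move=> xN; rewrite -[RHS]mulr1 -{1}(u_norm xN) -(u_norm eN) /a /b; ring.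
have a_lt1 x : x \in L0 -> a x < 1.
  move=> xL; rewrite -subr_gt0; have := u_norm (L0N _ xL); have := u_norm eN => ue uxx.
  have -> : 1 - a x = 2^-1 * ((ux x - ux e) ^+ 2 + (uy x - uy e) ^+ 2).
    by rewrite /a; lra.
  rewrite mulr_gt0// lt_neqAle addr_ge0 ?sqr_ge0// andbT eq_sym paddr_eq0 ?sqr_ge0//.
  rewrite !sqrf_eq0 !subr_eq0; apply/negP => /andP[/eqP xx /eqP yy].
  have xe : x = e by apply: direction_inj => //; exact: L0N.
  by move: N_uniq; rewrite NE /= -xe xL.
have a_neq1 x : x \in L0 -> 1 - a x != 0 by move=> /a_lt1; rewrite subr_eq0 eq_sym => /lt_eqF ->.
have k_inj : {in L0 &, injective k}.
  move=> x y xL yL kE.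
  have aE z : z \in L0 -> a z = (k z ^+ 2 - 1) / (k z ^+ 2 + 1).
    move=> zL; have k1 : k z ^+ 2 + 1 != 0 by rewrite gt_eqF// ltr_wpDl ?sqr_ge0.
    apply: (mulIf k1); rewrite mulfVK// /k expr_div_n.
    have -> : b z ^+ 2 = (1 - a z) * (1 + a z) by have := ab1 _ (L0N _ zL); lra.
    by field; exact: a_neq1.
  have axy : a x = a y by rewrite !aE// kE.
  have bxy : b x = b y by apply: (divIf (a_neq1 _ xL)); rewrite {2}axy; exact: kE.
  apply: direction_inj; rewrite ?L0N//.
    have uE z : ux z = ux e * a z - uy e * b z.
      by rewrite -[LHS]mulr1 -(u_norm eN) /a /b; ring.
    by rewrite !(uE x, uE y) axy bxy.
  have uE z : uy z = uy e * a z + ux e * b z.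
    by rewrite -[LHS]mulr1 -(u_norm eN) /a /b; ring.
  by rewrite !(uE x, uE y) axy bxy.
pose L := sort (fun x y => k y <= k x) L0.
have LE : perm_eq (e :: L) N by rewrite NE perm_cons perm_sort.
have LL0 x : (x \in L) = (x \in L0) by rewrite mem_sort.
have rot p : (\sum_(x <- p) c x * a x) ^+ 2 + (\sum_(x <- p) c x * b x) ^+ 2 =
    (\sum_(x <- p) c x * ux x) ^+ 2 + (\sum_(x <- p) c x * uy x) ^+ 2.
  have -> : \sum_(x <- p) c x * a x =
      (\sum_(x <- p) c x * ux x) * ux e + (\sum_(x <- p) c x * uy x) * uy e.
    rewrite !mulr_suml -big_split; apply: eq_bigr => x _ /=; rewrite /a; ring.
  have -> : \sum_(x <- p) c x * b x =
      ux e * (\sum_(x <- p) c x * uy x) - uy e * (\sum_(x <- p) c x * ux x).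
    rewrite !mulr_sumr -sumrB; apply: eq_bigr => x _ /=; rewrite /b; ring.
  rewrite -[RHS]mulr1 -(u_norm eN); ring.
have sum0 : \sum_(x <- e :: L) c x * a x = 0 /\ \sum_(x <- e :: L) c x * b x = 0.
  have := force_le N_uniq (fun x => id); rewrite M_sum0 normr0 admissible0 -rot expr0n/=.
  rewrite -!(perm_big _ LE) /= => le0.
  have : (\sum_(x <- e :: L) c x * a x) ^+ 2 + (\sum_(x <- e :: L) c x * b x) ^+ 2 == 0.
    by rewrite eq_le le0 addr_ge0 ?sqr_ge0.
  by rewrite paddr_eq0 ?sqr_ge0// !sqrf_eq0 => /andP[/eqP -> /eqP ->].
have ae : a e = 1 by rewrite /a -!expr2 u_norm.
have be : b e = 0 by rewrite /b; ring.
apply: (@convex_polygon_absurd R (fun t => C `|t| ^+ 2) _ _ _ T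
   (fun x => c x * a x) (fun x => c x * b x) M e L (fun x => c x * (1 - a x) / 2) k).
- by move=> t; rewrite normrN.
- by rewrite normr0 admissible0 expr0n.
- exact: admissible_neg_type4.
- move=> p sub; rewrite /defect rot subr_ge0; apply: force_le.
    by apply: subseq_uniq sub _; rewrite (perm_uniq LE).
  by move=> x /(mem_subseq sub); rewrite (perm_mem LE).
- move=> x; rewrite (perm_mem LE) => xN.
  by rewrite /defect !big_seq1 !exprMn -mulrDr ab1// mulr1 subrr.
- by have [+ _] := sum0; rewrite big_cons.
- by have [_] := sum0; rewrite big_cons be mulr0 add0r.
- by have := M_sum0; rewrite -(perm_big _ LE)/= big_cons.
- by rewrite ae mulr1 c_gt0.
- by rewrite be mulr0.
- move=> x; rewrite LL0 => xL; rewrite divr_gt0// mulr_gt0 ?c_gt0 ?L0N// subr_gt0.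
  exact: a_lt1.
- move=> x; rewrite LL0 => xL; rewrite /k expr_div_n.
  have -> : b x ^+ 2 = (1 - a x) * (1 + a x) by have := ab1 _ (L0N _ xL); lra.
  by field; exact: a_neq1.
- by move=> x; rewrite LL0 => xL; rewrite /k; field; exact: a_neq1.
- have : pairwise [rel x y | (k y <= k x) && (x != y)] L.
    rewrite pairwise_relI -uniq_pairwise sort_uniq.
    have : uniq N by []; rewrite NE /= => /andP[_ ->]; rewrite andbT.
    rewrite -sorted_pairwise; first by apply: sort_sorted => x y; exact: le_total.
    by move=> x y z /= + h; apply: le_trans.
  apply: (@sub_in_pairwise _ (mem L)); last exact/allP.
  move=> x y xL yL /= /andP[kxy xy]; rewrite lt_neqAle kxy andbT.
  by apply: contra xy => /eqP kE; apply/eqP/k_inj; rewrite -?LL0.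
- by rewrite size_sort; move: N_size; rewrite NE.
Qed.
End rotate.
End star.

(** * Points outside the support of a measure on the plane *)

Section support.
Local Open Scope classical_set_scope.
Local Open Scope ring_scope.
Variable R : realType.

(** An open set is the union of the boxes with rational corners inside it. *)
Lemma open_plane_measurable (U : set (plane R)) : open U -> measurable U.
Proof.
move=> oU.
pose box (q : (rat * rat) * (rat * rat)) : set (plane R) :=
  `]ratr q.1.1, ratr q.1.2[%classic `*` `]ratr q.2.1, ratr q.2.2[%classic.
have -> : U = \bigcup_q (if pselect (box q `<=` U) then box q else set0).
  apply/seteqP; split=> [v Uv|v [q _]]; last by case: pselect => // qU; exact: qU.
  have /nbhs_ballP[e /= e0 eU] : nbhs v U by apply: open_nbhs_nbhs.
  have near_rat (x : R) : exists q : rat * rat, ratr q.1 < x < ratr q.2 /\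
      (forall y, ratr q.1 < y < ratr q.2 -> ball x e y).
    have xe : x - e < x by rewrite ltrBlDr ltrDl.
    have ex : x < x + e by rewrite ltrDl.
    have [a] := rat_in_itvoo xe; rewrite in_itv /= => /andP[ea ax].
    have [b] := rat_in_itvoo ex; rewrite in_itv /= => /andP[xb be].
    exists (a, b); split; first by rewrite /= ax.
    by move=> y /= /andP[ay yb]; rewrite -ball_normE /= ltr_distlC; apply/andP; split; lra.
  have [q1 [v1 q1P]] := near_rat v.1; have [q2 [v2 q2P]] := near_rat v.2.
  exists (q1, q2) => //; case: pselect => [qU|[]]; first by split; rewrite /= in_itv.
  by move=> w [/=]; rewrite !in_itv/= => /q1P w1 /q2P w2; apply: eU; split.
apply: countable_bigcupT_measurable => // q; case: pselect => qU; last exact: measurable0.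
by apply: measurableX; exact: measurable_itv.
Qed.

Lemma measurable_plane_set1 (v : plane R) : measurable [set v].
Proof.
have -> : [set v] = [set v.1] `*` [set v.2].
  by apply/seteqP; split=> [w ->//|[a b] [/= -> ->]]; case: (v).
exact: measurableX.
Qed.

Lemma measure_notin_supp (mu : {measure set (plane R) -> \bar R}) (v : plane R) :
  ~ supp mu v -> mu [set v] = 0%E.
Proof.
move=> /existsNP[U /not_implyP[oU /not_implyP[Uv /negP]]]; rewrite -leNgt => muU.
apply/eqP; rewrite -measure_le0 (le_trans _ muU)// le_measure ?inE//.
- exact: measurable_plane_set1.
- exact: open_plane_measurable.
- by move=> _ ->.
Qed.
End support.

(** * Splitting a vertex of a flow *)

Section edges.
Local Open Scope fset_scope.
Local Open Scope ring_scope.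

Lemma fset2_eqP (T : choiceType) (a b c d : T) :
  [fset a; b] = [fset c; d] -> (a = c /\ b = d) \/ (a = d /\ b = c).
Proof.
move=> H; have aP : a \in [fset c; d] by rewrite -H !inE eqxx.
have bP : b \in [fset c; d] by rewrite -H !inE eqxx orbT.
have cP : c \in [fset a; b] by rewrite H !inE eqxx.
have dP : d \in [fset a; b] by rewrite H !inE eqxx orbT.
move: aP bP cP dP; rewrite !inE.
by move=> /orP[]/eqP aE /orP[]/eqP bE /orP[]/eqP cE /orP[]/eqP dE; subst; auto.
Qed.

Lemma big_fsetUD (T : choiceType) (Z : nmodType) (A B : {fset T}) (f : T -> Z) :
  [disjoint A & B] -> \sum_(x <- A `|` B) f x = \sum_(x <- A) f x + \sum_(x <- B) f x.
Proof.
move=> /fdisjointP AB; rewrite -big_cat; apply: perm_big; apply: uniq_perm => //.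
  rewrite cat_uniq !fset_uniq andbT /=; apply/hasPn => x xB.
  by apply: contraL xB => /AB.
by move=> x; rewrite mem_cat inE.
Qed.

Variable R : realType.
Implicit Types (a b c v x y : plane R) (J : {fset plane R}).

Definition star c J := [fset [fset c; x] | x in J].

Lemma starP c J e : reflect (exists2 x, x \in J & e = [fset c; x]) (e \in star c J).
Proof. by apply: (iffP (imfsetP _ _ _ _)) => -[x xJ ->]; exists x. Qed.

Lemma sum_star (Z : nmodType) c J (f : {fset plane R} -> Z) :
  \sum_(e <- star c J) f e = \sum_(x <- J) f [fset c; x].
Proof.
rewrite big_imfset// => x y _ _ /fset2_eqP[[]//|[-> ->]]; exact.
Qed.

(** Both the cost of a flow and the signed measure it transports have this form, which
lets a modification of the graph be analyzed for both at once. *)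
Definition edge_sum (h : R -> plane R -> plane R -> R) (E : {fset {fset plane R}})
  (m : plane R -> plane R -> R) : R :=
  \sum_(e <- E) let: (x, y) := ends e in h (m x y) x y.

Lemma endsE a b (g : plane R -> plane R -> R) :
  g a b = g b a -> (let: (x, y) := ends [fset a; b] in g x y) = g a b.
Proof.
move=> gab; have : [fset a; b] = [fset (ends [fset a; b]).1; (ends [fset a; b]).2].
  by apply: (@xgetPex _ _ [set p | [fset a; b] = [fset p.1; p.2]]%classic); exists (a, b).
by case: (ends _) => x y /= /fset2_eqP[] [<- <-].
Qed.
End edges.

Section split.
Local Open Scope fset_scope.
Local Open Scope ring_scope.
Variables (R : realType) (mup mum : {finite_measure set (plane R) -> \bar R}).
Variable F : flow mup mum.
Notation E := (flow_E F).
Notation V := (flow_V F).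
Notation m := (flow_m F).

Lemma flow_edgeE x y : [fset x; y] \in E -> [/\ x \in V, y \in V & x != y].
Proof.
by move=> /flow_edge[a [b [aV bV ab /fset2_eqP[] [-> ->]]]]; split=> //; rewrite eq_sym.
Qed.

Lemma flow_mN x y : [fset x; y] \in E -> m y x = - m x y.
Proof. by move=> /flow_anti /eqP; rewrite addrC addr_eq0 => /eqP. Qed.

Definition neighbors v := [fset x in V | [fset v; x] \in E].

Lemma neighborsP v x : (x \in neighbors v) = ([fset v; x] \in E).
Proof.
by rewrite !inE/=; apply: andb_idl => /flow_edgeE[].
Qed.

Lemma star_neighbors v : [fset e in E | v \in e] = star v (neighbors v).
Proof.
apply/fsetP => e; rewrite !inE /=; apply/andP/starP => [[eE]|[x]]; last first.
  by rewrite neighborsP => xE ->; rewrite xE !inE eqxx.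
have [x [y [_ _ _ exy]]] := flow_edge eE; rewrite exy !inE => /orP[] /eqP ve; subst v.
  by exists y => //; rewrite neighborsP -exy.
by exists x; rewrite 1?fsetUC// neighborsP fsetUC -exy.
Qed.

Lemma degreeE v : degree F v = #|` neighbors v|.
Proof.
rewrite /degree star_neighbors card_imfset// => x y /fset2_eqP[[]//|[-> ->]]; exact.
Qed.

Definition reversible (h : R -> plane R -> plane R -> R) :=
  forall t x y, h (- t) y x = h t x y.

Lemma edge_sum_star h v J : reversible h -> J `<=` neighbors v ->
  edge_sum h E m = edge_sum h (E `\` star v J) m + \sum_(x <- J) h (m v x) v x.
Proof.
move=> hN /fsubsetP JN.
have sE : star v J `<=` E.
  by apply/fsubsetP => _ /starP[x /JN + ->]; rewrite neighborsP.
have EE : E = (E `\` star v J) `|` star v J.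
  apply/fsetP => e; rewrite !inE; case: (boolP (e \in star v J)) => [/(fsubsetP sE) ->|_];
  by rewrite ?orbT ?orbF.
rewrite /edge_sum {1}EE big_fsetUD; last by apply/fdisjointP => e; rewrite !inE => /andP[].
rewrite sum_star; congr +%R; rewrite big_seq [RHS]big_seq; apply: eq_bigr => x /JN.
by rewrite neighborsP => xE; rewrite endsE // (flow_mN xE) hN.
Qed.

Lemma flow_eq_edge_sum (A : set (plane R)) : measurable A ->
  (mup A - mum A)%E =
  (edge_sum (fun t x y => t * ((y \in A)%:R - (x \in A)%:R)) E m)%:E.
Proof.
move=> mA; rewrite (flow_eq F mA) /edge_sum -sumEFin; apply: eq_bigr => e _.
by case: (ends e) => x y; rewrite !diracE EFinM EFinB.
Qed.

Lemma reversible_indicator (A : set (plane R)) :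
  reversible (fun t x y => t * ((y \in A)%:R - (x \in A)%:R)).
Proof. by move=> t x y; ring. Qed.

(** The law of Kirchhoff at [v]: the flow equation evaluated at the set [{v}]. *)
Lemma balance v : ~ supp mup v -> ~ supp mum v ->
  \sum_(x <- neighbors v) m v x = 0.
Proof.
move=> vp vm; have := flow_eq_edge_sum (measurable_plane_set1 v).
rewrite !measure_notin_supp// subee// => -[] /esym.
rewrite (edge_sum_star (reversible_indicator _) (fsubset_refl (neighbors v))).
rewrite [X in X + _]big1_seq => [|e /= /[!inE] /andP[eN eE]]; last first.
  have [x [y [xV yV xy exy]]] := flow_edge eE.
  have vNe : v \notin e.
    by apply: contra eN => ve; rewrite -star_neighbors !inE eE ve.
  move: vNe eE; rewrite exy !inE negb_or => /andP[vx vy] xyE.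
  rewrite endsE; last by rewrite (flow_mN xyE) mulNr -mulrN opprB.
  by rewrite !memNset ?subrr ?mulr0//= => xv; [move: vx | move: vy]; rewrite xv eqxx.
rewrite add0r => H; apply/eqP; rewrite -oppr_eq0 -sumrN -[X in _ == X]H; apply/eqP.
rewrite big_seq [RHS]big_seq; apply: eq_bigr => x.
rewrite neighborsP => /flow_edgeE[_ _ vx].
rewrite (mem_set (erefl : [set v]%classic v)) memNset ?sub0r ?mulrN1//= => xv.
by rewrite xv eqxx in vx.
Qed.

Section construction.
Variables (v v' : plane R) (J : {fset plane R}).
Hypotheses (vV : v \in V) (v'V : v' \notin V) (JN : J `<=` neighbors v).

(* The edges of a flow carry nonzero masses, so [v] and [v'] are joined only if
   the masses sent from [v] to [J] do not cancel. *)
Let mJ := \sum_(x <- J) m v x.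
Let link := if mJ == 0 then fset0 else [fset [fset v; v']].
Let E' := (E `\` star v J) `|` (star v' J `|` link).
Let m' x y :=
  if x == v' then (if y == v then - mJ else m v y)
  else if y == v' then (if x == v then mJ else m x v)
  else m x y.

Let neqv' x : x \in V -> (x == v') = false.
Proof. by apply: contraTF => /eqP ->. Qed.

Let JE x : x \in J -> [/\ [fset v; x] \in E, x \in V & x != v].
Proof.
by move=> /(fsubsetP JN); rewrite neighborsP => vx; have [_ ? ?] := flow_edgeE vx; rewrite eq_sym.
Qed.

Let E'P e : e \in E' ->
  [\/ e \in E `\` star v J, exists2 x, x \in J & e = [fset v'; x]
    | mJ != 0 /\ e = [fset v; v']].
Proof.
rewrite in_fsetU in_fsetU => /or3P[eE|/starP|]; [by constructor 1|by constructor 2|].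
rewrite /link; case: ifPn => [//|m0]; rewrite in_fset1 => /eqP ->; by constructor 3.
Qed.

Let m'E x y : [fset x; y] \in E -> m' x y = m x y.
Proof. by move=> /flow_edgeE[xV yV _]; rewrite /m' !neqv'. Qed.

Let m'J x : x \in J -> m' v' x = m v x /\ m' x v' = m x v.
Proof. by move=> /JE[_ xV /negbTE xv]; rewrite /m' eqxx xv neqv'. Qed.

Let m'link : m' v v' = mJ /\ m' v' v = - mJ.
Proof. by rewrite /m' !eqxx neqv'. Qed.

Let E'_edge e : e \in E' -> exists x y,
  [/\ x \in v' |` V, y \in v' |` V, x != y & e = [fset x; y]].
Proof.
move=> /E'P[|[x xJ ->]|[_ ->]].
- rewrite in_fsetD => /andP[_ /flow_edge[x [y [xV yV xy ->]]]].
  by exists x, y; rewrite !in_fsetU xV yV !orbT.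
- exists v', x; have [_ xV _] := JE xJ; rewrite !in_fsetU xV !in_fset1 eqxx orbT.
  by split=> //; rewrite eq_sym neqv'.
- by exists v, v'; rewrite !in_fsetU vV !in_fset1 eqxx orbT neqv'.
Qed.

Let E'_m x y : [fset x; y] \in E' -> m' x y != 0 /\ m' x y + m' y x = 0.
Proof.
move=> /E'P[|[z zJ]|[mJ0]].
- rewrite in_fsetD => /andP[_ xyE]; rewrite !m'E// 1?fsetUC//.
  by rewrite flow_neq0// flow_anti.
- have [vz zV _] := JE zJ; have [mz1 mz2] := m'J zJ.
  move=> /fset2_eqP[] [-> ->]; rewrite mz1 mz2; split.
  + exact: flow_neq0.
  + exact: flow_anti.
  + by rewrite flow_neq0// fsetUC.
  + by rewrite addrC flow_anti.
- have [ml1 ml2] := m'link.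
  by move=> /fset2_eqP[] [-> ->]; rewrite ml1 ml2 ?oppr_eq0 ?subrr ?addNr.
Qed.

Let E'_sum h : reversible h -> (forall x y, h 0 x y = 0) ->
  edge_sum h E' m' = edge_sum h E m +
    \sum_(x <- J) (h (m v x) v' x - h (m v x) v x) + h mJ v v'.
Proof.
move=> hN h0; rewrite (edge_sum_star hN JN) sumrB.
have notE x : [fset v'; x] \notin E.
  by apply/negP => /flow_edgeE[]; rewrite (negbTE v'V).
have dis1 : [disjoint E `\` star v J & star v' J `|` link].
  apply/fdisjointP => e; rewrite in_fsetD => /andP[_ eE]; rewrite in_fsetU negb_or.
  apply/andP; split; first by apply/negP => /starP[x _ ee]; move: eE; rewrite ee (negbTE (notE x)).
  rewrite /link; case: ifP => // _; rewrite in_fset1; apply: contraTneq eE => ->.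
  by rewrite fsetUC.
have dis2 : [disjoint star v' J & link].
  apply/fdisjointP => e /starP[x /JE[_ _ xv] ->]; rewrite /link; case: ifP => // _.
  rewrite in_fset1; apply/negP => /eqP/fset2_eqP[] [ab xE].
    by have := vV; rewrite -ab (negbTE v'V).
  by rewrite xE eqxx in xv.
rewrite /edge_sum !big_fsetUD// sum_star /=.
have -> : \sum_(e <- E `\` star v J) (let: (x, y) := ends e in h (m' x y) x y) =
          \sum_(e <- E `\` star v J) (let: (x, y) := ends e in h (m x y) x y).
  rewrite big_seq [RHS]big_seq; apply: eq_bigr => e; rewrite in_fsetD => /andP[_ eE].
  have [x [y [_ _ _ exy]]] := flow_edge eE; move: eE; rewrite exy => xyE.
  have yxE : [fset y; x] \in E by rewrite fsetUC.
  rewrite endsE; last by rewrite !m'E// (flow_mN xyE) hN.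
  by rewrite endsE ?m'E// (flow_mN xyE) hN.
have -> : \sum_(x <- J) (let: (a, b) := ends [fset v'; x] in h (m' a b) a b) =
          \sum_(x <- J) h (m v x) v' x.
  rewrite big_seq [RHS]big_seq; apply: eq_bigr => x xJ.
  have [vx _ _] := JE xJ; have [m1 m2] := m'J xJ.
  by rewrite endsE m1// m2 (flow_mN vx) hN.
have -> : \sum_(e <- link) (let: (a, b) := ends e in h (m' a b) a b) = h mJ v v'.
  rewrite /link; case: ifPn => [/eqP ->|m0]; first by rewrite big_seq_fset0 h0.
  by have [m1 m2] := m'link; rewrite big_seq_fset1 endsE m1// m2 hN.
ring.
Qed.

Let E'_eq (A : set (plane R)) : measurable A ->
  (mup A - mum A = \sum_(e <- E') let: (x, y) := ends e in
       (m' x y)%:E * (\d_y A - \d_x A))%E.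
Proof.
move=> mA; rewrite flow_eq_edge_sum//.
have -> : (\sum_(e <- E') (let: (x, y) := ends e in
       (m' x y)%:E * (\d_y A - \d_x A)) =
    (edge_sum (fun t x y => t * ((y \in A)%:R - (x \in A)%:R)) E' m')%:E)%E.
  rewrite /edge_sum -sumEFin; apply: eq_bigr => e _.
  by case: (ends e) => x y; rewrite !diracE EFinM EFinB.
congr EFin; rewrite (E'_sum (reversible_indicator A)) => [|x y]; last by rewrite mul0r.
rewrite -addrA -[LHS]addr0; congr +%R; rewrite /mJ mulr_suml -big_split /=.
by rewrite big1// => x _; ring.
Qed.

(** The edges from [v] to [J] are moved to [v'], and [v] sends to [v'] the mass that they
carry. Equal values of [edge_sum] for the indicator functions make this a flow
between the same measures. *)
Lemma split_flow : exists G : flow mup mum,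
  forall h, reversible h -> (forall x y, h 0 x y = 0) ->
  edge_sum h (flow_E G) (flow_m G) = edge_sum h E m +
    \sum_(x <- J) (h (m v x) v' x - h (m v x) v x) + h (\sum_(x <- J) m v x) v v'.
Proof.
have suppV : (signed_supp (fun A => mup A - mum A)%E `<=` [set` (v' |` V)%fset])%classic.
  by move=> x /(@flow_supp _ _ _ F)/= xV; rewrite in_fsetU xV orbT.
exists (@Flow R mup mum (v' |` V) E' m' suppV E'_edge (fun x y H => (E'_m H).1)
  (fun x y H => (E'_m H).2) E'_eq).
exact: E'_sum.
Qed.
End construction.
End split.

(** * First variation of the cost *)

Section cost.
Local Open Scope fset_scope.
Local Open Scope ring_scope.
Variable R : realType.

Lemma rhoC (x y : plane R) : rho x y = rho y x.
Proof. by rewrite /rho; congr Num.sqrt; ring. Qed.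

Lemma rho_gt0 (x y : plane R) : x != y -> 0 < rho x y.
Proof.
move=> xy; rewrite sqrtr_gt0 lt_neqAle addr_ge0 ?sqr_ge0// andbT eq_sym paddr_eq0 ?sqr_ge0//.
rewrite !sqrf_eq0 !subr_eq0; apply: contra xy => /andP[/eqP x1 /eqP x2].
by apply/eqP; case: x y x1 x2 => [? ?] [? ?] /= -> ->.
Qed.

Lemma rho_sqr (x y : plane R) : rho x y ^+ 2 = (x.1 - y.1) ^+ 2 + (x.2 - y.2) ^+ 2.
Proof. by rewrite sqr_sqrtr// addr_ge0 ?sqr_ge0. Qed.

(** This is [sqrt (d ^ 2 + b) <= d + b / (2 d)]: the first-order expansion of the distance,
with an explicit quadratic error. *)
Lemma rho_shift_le (v x u : plane R) : v != x ->
  rho (v.1 + u.1, v.2 + u.2) x <= rho v x +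
    (u.1 ^+ 2 + u.2 ^+ 2 - 2 * (u.1 * (x.1 - v.1) + u.2 * (x.2 - v.2))) / (2 * rho v x).
Proof.
move=> vx; have r0 := rho_gt0 vx; have rE := rho_sqr v x.
set q := _ / _.
have qE : 2 * rho v x * q =
    u.1 ^+ 2 + u.2 ^+ 2 - 2 * (u.1 * (x.1 - v.1) + u.2 * (x.2 - v.2)).
  by rewrite /q mulrC divfK// mulf_neq0 ?gt_eqF.
have e : (v.1 + u.1 - x.1) ^+ 2 + (v.2 + u.2 - x.2) ^+ 2 = rho v x ^+ 2 + 2 * rho v x * q.
  by rewrite rE qE; ring.
have q_ge : 0 <= rho v x + q.
  rewrite -(pmulr_rge0 _ (mulr_gt0 (ltr0Sn R 1) r0)) mulrDr.
  have : 0 <= rho v x ^+ 2 + 2 * rho v x * q by rewrite -e addr_ge0 ?sqr_ge0.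
  have := sqr_ge0 (rho v x); rewrite expr2; lra.
rewrite {1}/rho /= e -[leRHS]ger0_norm// -sqrtr_sqr ler_wsqrtr// sqrrD.
have := sqr_ge0 q; lra.
Qed.

(** A ray from [v] meets a finite set in finitely many points only, so it avoids
the set close to [v]. *)
Lemma shift_avoid (s : seq (plane R)) (v u : plane R) : u != (0, 0) ->
  exists2 c, 0 < c & forall e, 0 < e < c -> (v.1 + e * u.1, v.2 + e * u.2) \notin s.
Proof.
move=> u0; elim: s => [|x s [c c0 IH]]; first by exists 1.
have [[d [d0 dx]]|nd] := pselect (exists d, 0 < d /\ (v.1 + d * u.1, v.2 + d * u.2) = x).
  exists (Num.min c d); first by rewrite lt_min c0.
  move=> e /andP[e0]; rewrite lt_min => /andP[ec ed]; rewrite inE negb_or IH ?e0// andbT.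
  apply: contra u0 => /eqP ex; apply/eqP; rewrite -ex in dx; case: dx.
  move=> /addrI/eqP; rewrite -subr_eq0 -mulrBl mulf_eq0 subr_eq0 (gt_eqF ed)/= => /eqP u1.
  move=> /addrI/eqP; rewrite -subr_eq0 -mulrBl mulf_eq0 subr_eq0 (gt_eqF ed)/= => /eqP u2.
  by case: (u) u1 u2 => ? ? /= -> ->.
exists c => // e /andP[e0 ec]; rewrite inE negb_or IH ?e0// andbT.
by apply/negP => /eqP ex; apply: nd; exists e.
Qed.

Variables (mup mum : {finite_measure set (plane R) -> \bar R}) (C : R -> R).
Hypothesis C_ge0 : forall t : R, 0 <= t -> 0 <= C t.
Hypothesis C0 : C 0 = 0.
Variable F : flow mup mum.
Notation m := (flow_m F).

Definition dir_x v x : R := (x.1 - v.1) / rho v x.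
Definition dir_y v x : R := (x.2 - v.2) / rho v x.

(** Otherwise, moving the edges to [J] from [v] to [v + e w], where [w] is their total
force, changes the cost by at most [e (C(|m_J|) |w| - |w|^2) + e^2 |w|^2 B], which is
negative for small [e]. *)
Lemma minimal_force_le v (J : {fset plane R}) :
    (forall G : flow mup mum, gilbert C F <= gilbert C G) ->
    v \in flow_V F -> J `<=` neighbors F v ->
  (\sum_(x <- J) C `|m v x| * dir_x v x) ^+ 2 + (\sum_(x <- J) C `|m v x| * dir_y v x) ^+ 2 <=
  C `|\sum_(x <- J) m v x| ^+ 2.
Proof.
move=> Fmin vV JN; rewrite leNgt; apply/negP.
set wx := \sum_(x <- J) _ * dir_x v x; set wy := \sum_(x <- J) _ * dir_y v x.
set cJ := C `|_| => lt.
have cJ0 : 0 <= cJ by rewrite C_ge0.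
pose S := wx ^+ 2 + wy ^+ 2; pose r := Num.sqrt S.
have S0 : 0 < S by apply: le_lt_trans lt; rewrite sqr_ge0.
have r0 : 0 < r by rewrite sqrtr_gt0.
have rE : r ^+ 2 = S by rewrite sqr_sqrtr// ltW.
have cr : cJ < r by rewrite -ltr_sqr ?nnegrE ?(ltW r0)// rE.
pose B := \sum_(x <- J) C `|m v x| / (2 * rho v x).
have vJ x : x \in J -> v != x.
  by move=> /(fsubsetP JN); rewrite neighborsP => /flow_edgeE[].
have B0 : 0 <= B.
  rewrite /B big_seq sumr_ge0// => x /vJ/rho_gt0 ?.
  by rewrite divr_ge0 ?C_ge0// mulr_ge0// ltW.
have w0 : (wx, wy) != (0, 0) :> plane R.
  by apply: contraTneq S0 => -[wx0 wy0]; rewrite /S wx0 wy0 expr0n addr0 ltxx.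
have [c c0 cP] := shift_avoid (flow_V F) v w0.
pose D := r * (r - cJ) / (S * B + 1).
have SB : 0 < S * B + 1 by rewrite ltr_wpDl// mulr_ge0// ltW.
have D0 : 0 < D by rewrite divr_gt0// mulr_gt0// subr_gt0.
pose e := Num.min c D / 2.
have e0 : 0 < e by rewrite divr_gt0// lt_min c0.
have [ec eD] : e < c /\ e < D.
  have m0 : 0 < Num.min c D by rewrite lt_min c0.
  have : e < Num.min c D by rewrite /e; lra.
  by rewrite lt_min => /andP[].
pose v' : plane R := (v.1 + e * wx, v.2 + e * wy).
have v'V : v' \notin flow_V F by apply: cP; rewrite e0.
have [G GE] := split_flow vV v'V JN.
have := Fmin G; rewrite leNgt => /negP; apply.
pose h (t : R) (x y : plane R) := C `|t| * rho x y.
have hN : reversible h by move=> t x y; rewrite /h normrN rhoC.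
have gE (H : flow mup mum) : gilbert C H = edge_sum h (flow_E H) (flow_m H) by [].
rewrite !gE (GE h hN) => [|x y]; last by rewrite /h normr0 C0 mul0r.
rewrite -addrA gtrDl /h -/cJ.
have -> : rho v v' = e * r.
  rewrite /rho /= -[in RHS](ger0_norm (ltW e0)) -(sqrtr_sqr e) -sqrtrM ?sqr_ge0//.
  by congr Num.sqrt; rewrite /S; ring.
have le x : x \in J -> C `|m v x| * rho v' x - C `|m v x| * rho v x <=
   - e * (wx * (C `|m v x| * dir_x v x) + wy * (C `|m v x| * dir_y v x)) +
   e ^+ 2 * S * (C `|m v x| / (2 * rho v x)).
  move=> xJ; have vx := vJ _ xJ; have rx := rho_gt0 vx.
  have := @rho_shift_le v x (e * wx, e * wy) vx.
  rewrite /= -lerBlDl => H; rewrite -mulrBr.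
  apply: le_trans (ler_wpM2l (C_ge0 (normr_ge0 _)) H) _.
  rewrite le_eqVlt; apply/orP; left; apply/eqP.
  by rewrite /dir_x /dir_y /S; field; rewrite gt_eqF.
have {}le : \sum_(x <- J) (C `|m v x| * rho v' x - C `|m v x| * rho v x) <=
    - e * S + e ^+ 2 * S * B.
  rewrite big_seq; apply: (le_trans (ler_sum _ (fun x xJ => le x xJ))).
  rewrite -big_seq big_split /= -!mulr_sumr big_split /= -!mulr_sumr -/wx -/wy -/B.
  by rewrite /S -!expr2.
apply: (le_lt_trans (lerD le (lexx _))).
have -> : - e * S + e ^+ 2 * S * B + cJ * (e * r) = e * (e * (S * B) - r * (r - cJ)).
  by rewrite -rE; ring.
rewrite pmulr_rlt0// subr_lt0.
apply: le_lt_trans (_ : e * (S * B + 1) < _); first by rewrite ler_wpM2l ?(ltW e0)// lerDl.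
by rewrite -ltr_pdivlMr.
Qed.
End cost.

(** * Branching points of minimal flows *)

Theorem theorem3 (R : realType)
    (mup mum : {finite_measure set (plane R) -> \bar R})
    (fin_mup : finite_set (supp mup)) (fin_mum : finite_set (supp mum))
    (eq_mass : mup [set: plane R]%classic = mum [set: plane R]%classic)
    (C : R -> R) (C_ge0 : forall t : R, 0 <= t -> 0 <= C t)
    (C_adm : admissible C)
    (F : flow mup mum)
    (F_branch : exists v : plane R, branching_point F v /\ (4 <= degree F v)%N) :
  exists G : flow mup mum, gilbert C G < gilbert C F.
Proof.
have [v [[vV vp vm] deg]] := F_branch.
apply: contrapT => noG.
have Fmin (G : flow mup mum) : gilbert C F <= gilbert C G.
  by rewrite leNgt; apply/negP => ltG; apply: noG; exists G.
have vx x : x \in neighbors F v -> v != x by rewrite neighborsP => /flow_edgeE[].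
apply: (@star_absurd R C C_ge0 C_adm (plane R) (neighbors F v) (dir_x v) (dir_y v) (flow_m F v)).
- exact: fset_uniq.
- by rewrite -degreeE.
- move=> x /vx/rho_gt0 r0; rewrite /dir_x /dir_y !expr_div_n -mulrDl rho_sqr.
  rewrite -[X in X / _](_ : rho v x ^+ 2 = _); last by rewrite rho_sqr; ring.
  by rewrite -rho_sqr divff// expf_neq0// gt_eqF.
- by move=> x; rewrite neighborsP => /flow_neq0.
- exact: balance.
move=> p p_uniq pN.
have pE : perm_eq p [fset x in p]%fset by apply: uniq_perm => [||x]; rewrite ?fset_uniq ?inE.
rewrite !(perm_big _ pE) /=; apply: minimal_force_le => //.
  by apply: admissible0.
by apply/fsubsetP => x; rewrite -(perm_mem pE); exact: pN.
Qed.
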